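(* Let $\mathbb{K}$ be a field of characteristic $p>0$ with prime subfield $\mathbb{F}_p$, and let $n\geq 1$ be an integer. A matrix $A\in \mathrm{M}_n(\mathbb{K})$ is a sum of (finitely many) idempotent matrices of $\mathrm{M}_n(\mathbb{K})$ if and only if $\operatorname{tr} A\in\mathbb{F}_p$. In particular, every matrix of $\mathrm{M}_n(\mathbb{F}_p)$ is a sum of idempotents.
   Context: An idempotent matrix is a matrix $Q\in \mathrm{M}_n(\mathbb{K})$ with $Q^2=Q$. *)

(* Defs.v *)
From mathcomp Require Import all_boot all_algebra.

Set Implicit Arguments.
Unset Strict Implicit.
Unset Printing Implicit Defensive.

Import GRing.Theory.
Local Open Scope ring_scope.

(* In a field, [divring_closed S] says that S is a subfield: it contains 1 and
   is closed under subtraction and division (0^-1 = 0 is harmless here).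
   The prime subfield is the intersection of all subfields. *)
Definition in_prime_subfield (K : fieldType) (x : K) : Prop :=
  forall S : {pred K}, divring_closed S -> x \in S.

Definition idempotent_mx (K : fieldType) (n : nat) (Q : 'M[K]_n) : Prop :=
  Q *m Q = Q.

Definition sum_of_idempotents (K : fieldType) (n : nat) (A : 'M[K]_n) : Prop :=
  exists2 s : seq 'M[K]_n,
    {in s, forall Q, idempotent_mx Q} & A = \sum_(Q <- s) Q.

(* Main.v *)
Require Import Defs.
From mathcomp Require Import all_boot all_algebra.
From mathcomp Require Import ring.

Set Implicit Arguments.
Unset Strict Implicit.
Unset Printing Implicit Defensive.

Import GRing.Theory.
Local Open Scope ring_scope.

(** An idempotent factors through its image as [C *m R] with [R *m C = 1], so
    its trace is its rank. Conversely, in characteristic p the opposite of an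
    idempotent is a sum of p - 1 copies of it, so the sums of idempotents form
    an additive group. It contains every [E_ii], every [a E_ij] with i <> j
    (as [(E_ii + a E_ij) - E_ii]) and every [x (E_ii - E_jj)], because
    [[x, x(1-x)], [1, 1-x]] is idempotent; these matrices generate all the
    matrices with trace in the prime field. *)

Lemma mxtrace_idempotent (K : fieldType) (n : nat) (Q : 'M[K]_n) :
  idempotent_mx Q -> \tr Q = (\rank Q)%:R.
Proof.
rewrite /idempotent_mx => QQ.
have RC : row_base Q *m col_base Q = 1%:M.
  (* With [Q] = C R, the hypothesis reads C (R C) R = C R; full rank lets C be cancelled on the left
     and R on the right. *)
  apply: (row_full_inj (col_base_full Q)).
  apply: (row_free_inj (row_base_free Q)).
  by rewrite mulmx1 mulmxA -mulmxA !mulmx_base.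
by rewrite -{1}(mulmx_base Q) mxtrace_mulC RC mxtrace1.
Qed.

Lemma natr_in_prime_subfield (K : fieldType) (k : nat) :
  in_prime_subfield (k%:R : K).
Proof.
move=> S [S1 SB _].
have S0 : 0 \in S by rewrite -(subrr 1) SB.
elim: k => [|k IHk]; first by rewrite mulr0n.
have -> : k.+1%:R = k%:R - (0 - 1) :> K by rewrite sub0r opprK mulrSr.
by rewrite !SB.
Qed.

(** The images of 0, ..., p - 1 already form a subfield, so the intersection of all subfields lies
    inside them. The boolean form lets this set serve as the [S] of the definition. *)
Lemma in_prime_subfieldP (K : fieldType) (p : nat) (pcharK : p \in [pchar K])
    (x : K) :
  reflect (in_prime_subfield x) [exists k : 'I_p, x == k%:R].
Proof.
have p_gt0 : (0 < p)%N by rewrite prime_gt0 ?(pcharf_prime pcharK).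
apply: (iffP existsP) => [[k /eqP->]|]; first exact: natr_in_prime_subfield.
pose S := [pred y : K | [exists k : 'I_p, y == k%:R]].
have natS k : k%:R \in S.
  apply/existsP; exists (Ordinal (ltn_pmod k p_gt0)) => /=.
  by rewrite {1}(divn_eq k p) natrD natrM (pcharf0 pcharK) mulr0 add0r.
have memS y : y \in S -> exists k : nat, y = k%:R.
  by case/existsP=> k /eqP->; exists k.
move/(_ S)=> xS; apply/existsP/xS; split=> [|y z|y z].
- exact: (natS 1).
- move=> /memS[k ->] /memS[l ->].
  (* In characteristic p, -1 is the image of p - 1. *)
  have -> : k%:R - l%:R = (k + p.-1 * l)%:R :> K.
    by rewrite natrD natrM -subn1 natrB // (pcharf0 pcharK) sub0r mulN1r.
  exact: natS.
- move=> /memS[k ->] /memS[l ->].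
  have [->|l_neq0] := eqVneq (l%:R : K) 0; first by rewrite invr0 mulr0 (natS 0).
  (* Frobenius fixes the images of naturals, so a nonzero l satisfies l^(p-1) = 1 and has inverse
     l^(p-2). *)
  have lp : (l%:R : K) ^+ p = l%:R.
    by rewrite -(pFrobenius_autE pcharK) pFrobenius_aut_nat.
  have -> : k%:R / l%:R = (k * l ^ p.-2)%:R :> K.
    rewrite natrM natrX; congr (_ * _); apply: (mulfI l_neq0).
    rewrite mulfV // -exprS; apply: (mulfI l_neq0).
    by rewrite mulr1 -exprS !prednK // -ltnS prednK // prime_gt1 ?(pcharf_prime pcharK).
  exact: natS.
Qed.

Section SumsOfIdempotents.

Variables (K : fieldType) (p : nat) (pcharK : p \in [pchar K]) (n : nat).
Implicit Types A B Q : 'M[K]_n.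

Lemma sum_of_idempotents0 : sum_of_idempotents (0 : 'M[K]_n).
Proof. by exists [::]; rewrite ?big_nil. Qed.

Lemma sum_of_idempotents1 Q : idempotent_mx Q -> sum_of_idempotents Q.
Proof.
by move=> idQ; exists [:: Q]; rewrite ?big_seq1 // => B; rewrite inE => /eqP->.
Qed.

Lemma sum_of_idempotentsD A B :
  sum_of_idempotents A -> sum_of_idempotents B -> sum_of_idempotents (A + B).
Proof.
move=> [s ids ->] [t idt ->]; exists (s ++ t); last by rewrite big_cat.
by move=> Q; rewrite mem_cat => /orP[/ids|/idt].
Qed.

Lemma sum_of_idempotents_sum (I : finType) (F : I -> 'M[K]_n) :
  (forall i, sum_of_idempotents (F i)) -> sum_of_idempotents (\sum_i F i).
Proof.
move=> idF; apply: big_ind => //; first exact: sum_of_idempotents0.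
exact: sum_of_idempotentsD.
Qed.

Lemma sum_of_idempotentsMn A k :
  sum_of_idempotents A -> sum_of_idempotents (A *+ k).
Proof.
move=> idA; elim: k => [|k IHk]; first exact: sum_of_idempotents0.
by rewrite mulrS; apply: sum_of_idempotentsD.
Qed.

Lemma sum_of_idempotentsB A B :
  sum_of_idempotents A -> sum_of_idempotents B -> sum_of_idempotents (A - B).
Proof.
move=> idA idB; apply: sum_of_idempotentsD => //.
have -> : - B = B *+ p.-1.
  apply/eqP; rewrite eq_sym -addr_eq0 -mulrSr prednK ?prime_gt0 //.
    by rewrite -scaler_nat (pcharf0 pcharK) scale0r.
  exact: (pcharf_prime pcharK).
exact: sum_of_idempotentsMn.
Qed.

(** Reduces idempotence of a rank one matrix to a 1 x 1 identity, since (u v)(u v) = u (v u) v. *)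
Lemma sum_of_idempotents_rank1 (u : 'cV[K]_n) (v : 'rV[K]_n) :
  v *m u = 1%:M -> sum_of_idempotents (u *m v).
Proof.
move=> vu; apply: sum_of_idempotents1.
by rewrite /idempotent_mx mulmxA -(mulmxA u) vu mulmx1.
Qed.

Lemma sum_of_idempotents_delta_diag (i : 'I_n) :
  sum_of_idempotents (delta_mx i i : 'M[K]_n).
Proof.
by apply: sum_of_idempotents1; rewrite /idempotent_mx mul_delta_mx.
Qed.

Lemma sum_of_idempotents_delta_offdiag (a : K) (i j : 'I_n) :
  i != j -> sum_of_idempotents (a *: delta_mx i j : 'M[K]_n).
Proof.
move=> neq_ij; rewrite -[_ *: _](addrK (delta_mx i i)).
apply: sum_of_idempotentsB (sum_of_idempotents_delta_diag i).
have -> : a *: delta_mx i j + delta_mx i i =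
    delta_mx i (0 : 'I_1) *m (a *: delta_mx 0 j + delta_mx 0 i) :> 'M[K]_n.
  by rewrite mulmxDr -scalemxAr !mul_delta_mx.
apply: sum_of_idempotents_rank1.
rewrite mulmxDl -scalemxAl mul_delta_mx mul_delta_mx_0 1?eq_sym //.
by rewrite scaler0 add0r; apply/matrixP=> k l; rewrite !ord1 !mxE.
Qed.

Lemma sum_of_idempotents_delta_sub (x : K) (i j : 'I_n) :
  sum_of_idempotents (x *: (delta_mx i i - delta_mx j j) : 'M[K]_n).
Proof.
have [->|neq_ij] := eqVneq i j.
  by rewrite subrr scaler0; apply: sum_of_idempotents0.
have neq_ji : j != i by rewrite eq_sym.
(* On the coordinates i, j: [u] = (x, 1)^T and [v] = (1, 1 - x), so v u = x + (1 - x) = 1 and u v =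
   [[x, x(1-x)], [1, 1-x]]. *)
pose u : 'cV[K]_n := x *: delta_mx i 0 + delta_mx j 0.
pose v : 'rV[K]_n := delta_mx 0 i + (1 - x) *: delta_mx 0 j.
have vu : v *m u = 1%:M.
  rewrite mulmxDl !mulmxDr -!scalemxAl -!scalemxAr !mul_delta_mx.
  rewrite !mul_delta_mx_0 // !scaler0 addr0 add0r -scalerDl addrC subrK.
  by rewrite scale1r; apply/matrixP=> k l; rewrite !ord1 !mxE.
have -> : x *: (delta_mx i i - delta_mx j j) =
    u *m v - delta_mx j j - (x * (1 - x)) *: delta_mx i j
      - 1 *: delta_mx j i :> 'M[K]_n.
  rewrite mulmxDl !mulmxDr -!scalemxAl -!scalemxAr !mul_delta_mx scalerA.
  by apply/matrixP=> k l; rewrite !mxE; ring.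
do 2?[apply: sum_of_idempotentsB].
- apply: sum_of_idempotentsB (sum_of_idempotents_delta_diag j).
  exact: sum_of_idempotents_rank1.
- exact: sum_of_idempotents_delta_offdiag.
- exact: sum_of_idempotents_delta_offdiag.
Qed.

Lemma sum_of_idempotents_natr_trace (A : 'M[K]_n) (i0 : 'I_n) (k : nat) :
  \tr A = k%:R -> sum_of_idempotents A.
Proof.
move=> trA.
(* Each diagonal entry is balanced by its opposite at [i0]; the total correction there is the trace,
   that is [k] copies of an idempotent. *)
pose N i j : 'M[K]_n := if i == j then A i i *: (delta_mx i i - delta_mx i0 i0)
  else A i j *: delta_mx i j.
have -> : A = \sum_i \sum_j N i j + delta_mx i0 i0 *+ k.
  have NE i : \sum_j N i j =
      \sum_j A i j *: delta_mx i j - A i i *: delta_mx i0 i0.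
    rewrite (bigD1 i) //= [in RHS](bigD1 i) //= /N eqxx scalerBr addrAC.
    by congr (_ + _ - _); apply: eq_bigr => j /negPf; rewrite eq_sym => ->.
  under eq_bigr do rewrite NE.
  rewrite sumrB -scaler_suml -/(\tr A) trA scaler_nat subrK.
  exact: matrix_sum_delta.
apply: sum_of_idempotentsD.
  apply: sum_of_idempotents_sum => i; apply: sum_of_idempotents_sum => j.
  rewrite /N; case: eqVneq => [_|]; first exact: sum_of_idempotents_delta_sub.
  exact: sum_of_idempotents_delta_offdiag.
exact/sum_of_idempotentsMn/sum_of_idempotents_delta_diag.
Qed.

End SumsOfIdempotents.

Theorem theorem4 (K : fieldType) (p : nat) (pcharK : p \in [pchar K])
    (n : nat) (n_gt0 : (0 < n)%N) :
  (forall A : 'M[K]_n, sum_of_idempotents A <-> in_prime_subfield (\tr A)) /\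
  (forall B : 'M['F_p]_n, sum_of_idempotents B).
Proof.
pose i0 := Ordinal n_gt0; split=> [A|B].
  split=> [[s ids ->]|/(in_prime_subfieldP pcharK)/existsP[k /eqP trA]].
    (* The trace of the sum is the sum of the ranks, a natural number. *)
    rewrite raddf_sum /= big_seq.
    under eq_bigr => Q Qs do rewrite (mxtrace_idempotent (ids Q Qs)).
    by rewrite -natr_sum; apply: natr_in_prime_subfield.
  exact: (sum_of_idempotents_natr_trace pcharK i0 trA).
have p_pr := pcharf_prime pcharK.
(* Every element of ['F_p] is the image of its own representative, read here as a natural number. *)
apply: (sum_of_idempotents_natr_trace (pchar_Fp p_pr) i0 (k := \tr B)).
by rewrite natr_Zp.
Qed.
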